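(* Let $f(x) = \sum_{n=0}^{\infty} a_n x^n$. Assume that $f(x)$ satisfies a homogeneous linear differential equation with polynomial coefficients of order $r$ and degree $k$, $$\sum_{\alpha} \left[ q_{\alpha,0}(x)f(\alpha x)+ q_{\alpha,1}(x)f'(\alpha x) + \dots + q_{\alpha,r}(x)f^{(r)}(\alpha x)\right] = 0,$$ where $\alpha$ ranges over a finite set of complex numbers and each $q_{\alpha,t}(x)$ is a polynomial of degree at most $k$. Then $(a_n)_{n\ge0}$ is a $C^2$-finite sequence of order at most $r+k$ and degree at most $r$.
   Context: Sequences are indexed by $n=0,1,2,\dots$ and have complex values; generating functions are formal power series. A sequence $(C_n)_{n\ge0}$ is $C$-finite if it satisfies a homogeneous linear recurrence with constant coefficients $C_{n+d} + c_{d-1}C_{n+d-1}+\dots+c_0 C_n=0$ for all $n\ge 0$; its characteristic polynomial is $N^d+c_{d-1}N^{d-1}+\dots+c_0$. A closed-form formula for such a sequence is $C_n=\sum_{\alpha\in S}p_\alpha(n)\alpha^n$, where $S$ is the set of roots of the characteristic polynomial and the $p_\alpha$ are polynomials. $Deg(C_n)$ denotes the highest degree of the $p_\alpha(n)$, $\alpha\in S$. A sequence $(a_n)_{n\ge 0}$ is $C^2$-finite if it is defined by a linear recurrence with $C$-finite sequence coefficients $$C_{m,n}a_{n+m} + C_{m-1,n}a_{n+m-1}+ \dots + C_{0,n}a_{n} = 0,$$ where each $(C_{i,n})_{n\ge0}$ is $C$-finite and $C_{m,n}\neq 0$ for all $n=0,1,2,\dots$, along with initial values $a_0,\dots,a_{m-1}$.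 It is said to have order $m$ and degree $d$ if it satisfies such a recurrence in which $Deg(C_{i,n})\le d$ for each $0\le i\le m$. Notation: $f^{(j)}(\alpha x)$ means $\dfrac{d^j f(\alpha x)}{dx^j}$, i.e. the $j$-th derivative with respect to $x$ of the composite $x\mapsto f(\alpha x)$ (and $f'(\alpha x)$ is the case $j=1$).
   Formalization: Added assumption: for one fixed shift, the operator sends each x^N with N ≥ r+k to a nonzero series of order exactly N minus that shift, so the leading C_{m,n} never vanishes; without it the claim fails, e.g. x f' − 5f = 0 with f = x^5. *)

(* Defs.v *)
From mathcomp Require Import all_boot all_order all_algebra.
From mathcomp Require Import reals.
From mathcomp.real_closed Require Export complex.

Set Implicit Arguments.
Unset Strict Implicit.
Unset Printing Implicit Defensive.

Import Order.TTheory GRing.Theory Num.Theory.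
Local Open Scope ring_scope.

(* A formal power series over K is represented by its sequence of coefficients
   [nat -> K]; the sequence (a_n) and its generating function are thus the same
   object. *)
Section PowerSeries.
Variable K : fieldType.
Implicit Types (a b : nat -> K) (p : {poly K}) (A : seq K)
  (q : K -> nat -> {poly K}).

Definition ps_monomial (N : nat) : nat -> K := fun n => (n == N)%:R.

(* f(x) |-> f(al x); since 0 ^+ 0 = 1, f(0 x) is the constant series f(0). *)
Definition ps_scale (al : K) a : nat -> K := fun n => al ^+ n * a n.

Definition ps_deriv a : nat -> K := fun n => n.+1%:R * a n.+1.

Definition ps_polymul p a : nat -> K :=
  fun n => \sum_(i < n.+1) p`_i * a (n - i)%N.

(* f |-> \sum_(al in A) \sum_(t <= r) q_(al,t)(x) (d/dx)^t [f(al x)]: the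
   derivative is that of the composite, so scaling is done first. *)
Definition diffop A (r : nat) q a : nat -> K :=
  fun n => \sum_(al <- A) \sum_(t < r.+1)
             ps_polymul (q al t) (iter t ps_deriv (ps_scale al a)) n.

(* b is a nonzero series whose lowest-degree term has degree v. *)
Definition ps_order b (v : nat) : Prop :=
  b v != 0 /\ forall i, (i < v)%N -> b i = 0.

(* The operator shifts the order of every monomial x^N, N >= N0, by one and the
   same amount e - r: the lowest coefficient of its value at x^N never vanishes.
   For a differential operator (A = [:: 1]) this says that the indicial
   polynomial at 0 has no root N >= N0.  That coefficient is the coefficient of
   a_N, the term of highest index, in the recurrence that the equation induces
   on (a_n), so its zeros are the obstruction to a leading coefficient that is
   nonzero at every n: x f' = 5 f has the solution x^5, and the solutions of
   f(x) - f(-x) = 0 are all the even series. *)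
Definition nonresonant A (r : nat) q (N0 : nat) : Prop :=
  exists e : nat, forall N, (N0 <= N)%N ->
    ps_order (diffop A r q (ps_monomial N)) (N - r + e)%N.

End PowerSeries.

Section CFinite.
Variable K : fieldType.
Implicit Types (c a : nat -> K) (chi : {poly K}).

(* c satisfies the recurrence with characteristic polynomial chi, whose order
   is (size chi).-1. *)
Definition char_poly_of chi c : Prop :=
  chi \is monic /\ forall n, \sum_(i < size chi) chi`_i * c (n + i)%N = 0.

Definition C_finite c : Prop := exists chi, char_poly_of chi c.

(* S lists, without repetition, the roots of a characteristic polynomial of c.
   With 0 ^+ 0 = 1, a root 0 contributes p_0(0) at n = 0 only. *)
Definition closed_form c (S : seq K) (p : K -> {poly K}) : Prop :=
  [/\ uniq S,
      exists2 chi, char_poly_of chi c & forall z, (z \in S) = root chi z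
    & forall n, c n = \sum_(al <- S) (p al).[n%:R] * al ^+ n].

(* Deg(c) <= d, i.e. size (p al) <= d + 1 for every root al. *)
Definition Deg_le c (d : nat) : Prop :=
  exists S p, closed_form c S p /\
    forall al, al \in S -> (size (p al) <= d.+1)%N.

(* a is C^2-finite of order m and degree d; C i is the coefficient sequence of
   a_(n+i), and only C 0, ..., C m matter. *)
Definition C2_finite a (m d : nat) : Prop :=
  exists C : nat -> nat -> K,
    [/\ forall i, (i <= m)%N -> C_finite (C i) /\ Deg_le (C i) d,
        forall n, C m n != 0
      & forall n, \sum_(i < m.+1) C i n * a (n + i)%N = 0].

End CFinite.

(* Main.v *)
Require Import Defs.
From mathcomp Require Import all_boot all_order all_algebra.
From mathcomp Require Import reals.
From mathcomp.real_closed Require Import complex.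
From mathcomp Require Import zify ring.

(** A differential operator with dilations acts on power series by an infinite
    matrix: if L(N, n) is the coefficient of x^n in its value at x^N, then the
    equation for f = \sum_N a_N x^N reads \sum_N L(N, n) a_N = 0 for every n.
    The term x^i (d/dx)^t [f(al x)] sends x^N to N(N-1)...(N-t+1) al^N x^(N+i-t)
    with 0 <= i <= k and 0 <= t <= r, so the matrix is banded, and along each
    diagonal n - N = s the entry is \sum_al P_al(N) al^N with polynomials P_al
    of degree at most r ([diffop_monomialE]).  Such exponential polynomials are
    C-finite, annihilated by the power \prod_al ('X - al)^(r+1)
    ([exp_poly_C_finite]), which gives the degree bound.

    The remaining point is the leading coefficient.  If nonresonance holds with
    exponent e, the highest index N with L(N, n) != 0 is n + r - e as soon as
    this number is at least r + k.  Reading the equation in degree n + k + e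
    therefore gives a relation between a_n, ..., a_(n+r+k) whose leading
    coefficient, the entry of the matrix at N = n + r + k >= r + k, is nonzero
    for every n >= 0.  So the order can always be taken to be exactly r + k. *)

Set Implicit Arguments.
Unset Strict Implicit.
Unset Printing Implicit Defensive.

Import Order.TTheory GRing.Theory Num.Theory.
Local Open Scope ring_scope.

(** * Exponential polynomials are C-finite *)

Section ExponentialPolynomials.
Variable K : fieldType.
Implicit Types (p chi : {poly K}) (c : nat -> K) (al : K).

(** The action of K['X] on sequences in which 'X is the shift. *)
Definition shift_act p c : nat -> K :=
  fun n => \sum_(i < size p) p`_i * c (n + i)%N.

Lemma shift_act_widen p c n m : (size p <= m)%N ->
  shift_act p c n = \sum_(i < m) p`_i * c (n + i)%N.
Proof.
move=> le_pm; rewrite /shift_act.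
rewrite (big_ord_widen m (fun i => p`_i * c (n + i)%N) le_pm) big_mkcond /=.
apply: eq_bigr => i _; case: ltnP => // le_pi.
by rewrite nth_default ?mul0r.
Qed.

Lemma eq_shift_act p c1 c2 : c1 =1 c2 -> shift_act p c1 =1 shift_act p c2.
Proof. by move=> eq_c n; apply: eq_bigr => i _; rewrite eq_c. Qed.

Lemma shift_act_mulXsubC p al c n :
  shift_act (p * ('X - al%:P)) c n =
  shift_act p (fun j => c j.+1 - al * c j) n.
Proof.
have le_s : (size (p * ('X - al%:P))%R <= (size p).+1)%N.
  by rewrite (leq_trans (size_polyMleq _ _)) // size_XsubC addn2.
rewrite (shift_act_widen _ _ le_s).
under eq_bigr => i _ do rewrite mulrBr coefB coefMX coefMC mulrBl.
rewrite sumrB big_ord_recl /= mul0r add0r [X in _ - X]big_ord_recr /=.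
rewrite (nth_default 0 (leqnn (size p))) !mul0r addr0 -sumrB.
by apply: eq_bigr => i _; rewrite mulrBr addnS mulrA.
Qed.

Lemma size_comp_XaddC p al : size (p \Po ('X + al%:P)) = size p.
Proof. by rewrite size_comp_poly2 // size_XaddC. Qed.

(** The leading coefficients of p('X + 1) and p cancel.  Writing p as u 'X + b,
    the difference is (u('X + 1) - u) 'X + u('X + 1), whence the induction. *)
Lemma size_forward_diff p d : (size p <= d.+1)%N ->
  (size (p \Po ('X + 1%:P) - p)%R <= d)%N.
Proof.
elim/poly_ind: p d => [|u b IHu] d.
  by rewrite comp_poly0 subrr size_poly0.
have [-> _|u_neq0] := eqVneq u 0.
  by rewrite mul0r add0r comp_polyC subrr size_poly0.
rewrite size_MXaddC (negPf u_neq0) /= ltnS => le_ud.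
have -> : (u * 'X + b%:P) \Po ('X + 1%:P) - (u * 'X + b%:P) =
          (u \Po ('X + 1%:P) - u) * 'X + (u \Po ('X + 1%:P)).
  by rewrite comp_poly_MXaddC mulrDr mulr1 mulrBl; ring.
case: d le_ud => [|d] le_ud.
  by rewrite leqn0 size_poly_eq0 (negPf u_neq0) in le_ud.
rewrite (leq_trans (size_polyD _ _)) // geq_max size_comp_XaddC le_ud andbT.
by rewrite (leq_trans (size_polyMleq _ _)) // size_polyX addn2 ltnS IHu.
Qed.

(** The operator 'X - al turns p(n) al^n into al (p(n+1) - p(n)) al^n, so each
    application lowers the degree of the polynomial factor. *)
Lemma shift_act_exp_poly chi al d p : (size p <= d)%N ->
  shift_act (chi * ('X - al%:P) ^+ d) (fun n => p.[n%:R] * al ^+ n) =1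
  fun=> 0.
Proof.
elim: d p => [|d IHd] p le_pd n.
  move: le_pd; rewrite leqn0 size_poly_eq0 => /eqP->.
  by rewrite /shift_act big1 // => i _; rewrite horner0 mul0r mulr0.
rewrite exprSr mulrA shift_act_mulXsubC.
set p1 := al *: (p \Po ('X + 1%:P) - p).
rewrite (@eq_shift_act _ _ (fun j => p1.[j%:R] * al ^+ j)) => [|j].
  rewrite IHd // (leq_trans (size_scale_leq _ _)) //.
  exact: size_forward_diff.
rewrite /p1 hornerZ hornerD hornerN horner_comp hornerD hornerX hornerC.
by rewrite -natr1 exprS; ring.
Qed.

(** The multiplicity d + 1 is the same at each base, so that the roots of the
    characteristic polynomial are exactly the bases in S, including those whose
    polynomial p al has smaller degree or vanishes. *)
Lemma exp_poly_C_finite (S : seq K) (p : K -> {poly K}) c d : uniq S ->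
    (forall al, al \in S -> (size (p al) <= d.+1)%N) ->
    (forall n, c n = \sum_(al <- S) (p al).[n%:R] * al ^+ n) ->
  C_finite c /\ Deg_le c d.
Proof.
move=> S_uniq le_p cE.
pose chi := (\prod_(z <- S) ('X - z%:P)) ^+ d.+1.
have chi_c : char_poly_of chi c.
  split=> [|n]; first by rewrite monic_exp // monic_prod_XsubC.
  under eq_bigr => i _ do rewrite cE mulr_sumr.
  rewrite exchange_big big_seq big1 //= => al al_S.
  rewrite -[LHS]/(shift_act chi (fun n => (p al).[n%:R] * al ^+ n) n).
  rewrite /chi (big_rem al al_S) /= mulrC exprMn.
  exact: shift_act_exp_poly (le_p al al_S) n.
split; first by exists chi.
exists S, p; split=> //; split=> //; exists chi => // z.
by rewrite rootE horner_exp expf_eq0 /= -rootE root_prod_XsubC.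
Qed.

End ExponentialPolynomials.

(** * The matrix of a differential operator with dilations *)

Section OperatorMatrix.
Variable K : fieldType.
Implicit Types (a : nat -> K) (A : seq K) (q : K -> nat -> {poly K}).

Lemma iter_ps_deriv t (b : nat -> K) n :
  iter t (@ps_deriv K) b n = ((n + t) ^_ t)%:R * b (n + t)%N.
Proof.
elim: t n => [|t IHt] n /=; first by rewrite ffactn0 mul1r addn0.
rewrite /ps_deriv IHt mulrA -natrM addSnnS; congr (_%:R * _).
by rewrite ffactnSr mulnC; congr (_ * _)%N; lia.
Qed.

Lemma diffopE A r q a n : diffop A r q a n =
  \sum_(al <- A) \sum_(t < r.+1) \sum_(i < n.+1)
     (q al t)`_i *
     (((n - i + t) ^_ t)%:R * (al ^+ (n - i + t) * a (n - i + t)%N)).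
Proof.
apply: eq_bigr => al _; apply: eq_bigr => t _; apply: eq_bigr => i _.
by rewrite iter_ps_deriv.
Qed.

(** The degree n coefficient only involves derivatives of order at most r, hence
    only the a_N with N <= n + r. *)
Lemma diffop_monomial_sum A r q a n :
  diffop A r q a n =
  \sum_(N < (n + r).+1) diffop A r q (ps_monomial K N) n * a N.
Proof.
rewrite diffopE; symmetry; under eq_bigr => N _ do rewrite diffopE mulr_suml.
rewrite exchange_big; apply: eq_bigr => al _ /=.
under eq_bigr => N _ do rewrite mulr_suml.
rewrite exchange_big; apply: eq_bigr => t _ /=.
under eq_bigr => N _ do rewrite mulr_suml.
rewrite exchange_big; apply: eq_bigr => i _ /=.
have lt_N : (n - i + t < (n + r).+1)%N by have := ltn_ord t; lia.
rewrite (bigD1 (Ordinal lt_N)) //= big1 => [|N /negPf neqN].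
  by rewrite /ps_monomial eqxx mulr1 addr0; ring.
have -> : ps_monomial K N (n - i + t)%N = 0.
  by rewrite /ps_monomial eq_sym -(inj_eq val_inj) /= in neqN *; rewrite neqN.
by rewrite !mulr0 mul0r.
Qed.

(** The (t, i) term of the operator contributes to x^n for i = n + t - N only;
    when t > N this index would exceed n, but then the falling factorial
    N(N-1)...(N-t+1) vanishes. *)
Lemma diffop_monomialE A r q N n : diffop A r q (ps_monomial K N) n =
  \sum_(al <- A) (\sum_(t < r.+1 | (N <= n + t)%N)
     (q al t)`_(n + t - N) * (N ^_ t)%:R) * al ^+ N.
Proof.
rewrite diffopE; apply: eq_bigr => al _; rewrite mulr_suml [RHS]big_mkcond.
apply: eq_bigr => t _ /=.
have [le_N|lt_N] := leqP N (n + t); last first.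
  rewrite big1 // => i _; rewrite /ps_monomial; case: eqP => [|_]; first lia.
  by rewrite !mulr0.
have [lt_Nt|le_tN] := ltnP N t.
  rewrite ffact_small // mulr0 mul0r big1 // => i _.
  rewrite /ps_monomial; case: eqP => [|_]; last by rewrite !mulr0.
  by move=> E; rewrite E ffact_small // mul0r mulr0.
have lt_i : (n + t - N < n.+1)%N by lia.
rewrite (bigD1 (Ordinal lt_i)) //= big1 => [|i /negPf neq_i].
  have -> : (n - (n + t - N) + t = N)%N by lia.
  by rewrite /ps_monomial eqxx mulr1 addr0 mulrA.
rewrite /ps_monomial; case: eqP => [E|_]; last by rewrite !mulr0.
move: neq_i; rewrite -(inj_eq val_inj) /=.
by case: eqP => //; have := ltn_ord i; lia.
Qed.

Lemma diffop_monomial_low A r q k N n :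
    (forall al t, al \in A -> (t <= r)%N -> (size (q al t) <= k.+1)%N) ->
  (N + k < n)%N -> diffop A r q (ps_monomial K N) n = 0.
Proof.
move=> q_deg lt_n; rewrite diffop_monomialE big_seq big1 // => al al_A.
rewrite big1 ?mul0r // => t _; rewrite nth_default ?mul0r //.
by rewrite (leq_trans (q_deg al t al_A _)) ?leq_ord //; lia.
Qed.

(** The falling factorial of length t of 'X + i. *)
Definition ffact_poly (i t : nat) : {poly K} :=
  \prod_(j < t) ('X + (i%:R - j%:R)%:P).

Lemma horner_ffact_poly i t n :
  (ffact_poly i t).[n%:R] = ((n + i) ^_ t)%:R.
Proof.
rewrite horner_prod ffact_prod natr_prod.
(* When n + i < t the factors do not agree one by one: those of index
   j > n + i are n + i - j on the left and truncated to 0 on the right.  Both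
   products vanish because of the factor of index n + i. *)
have [lt_t|le_t] := ltnP (n + i) t.
  rewrite (bigD1 (Ordinal lt_t)) //= [RHS](bigD1 (Ordinal lt_t)) //=.
  by rewrite hornerD hornerX hornerC subnn !natrD; ring.
apply: eq_bigr => j _; rewrite hornerD hornerX hornerC natrB ?natrD; first ring.
by have := ltn_ord j; lia.
Qed.

Lemma size_ffact_poly i t : size (ffact_poly i t) = t.+1.
Proof.
rewrite size_prod => [|j _]; last by rewrite -size_poly_eq0 size_XaddC.
under eq_bigr => j _ do rewrite size_XaddC.
by rewrite sum_nat_const card_ord; lia.
Qed.

(** A diagonal of the matrix, here the entries (n + i, n + s): only the falling
    factorials of N = n + i depend on n in the coefficient of al^n. *)
Lemma diffop_diagonal_C_finite A r q i s : uniq A ->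
  let c n := diffop A r q (ps_monomial K (n + i)) (n + s) in
  C_finite c /\ Deg_le c r.
Proof.
move=> A_uniq c.
pose p al := al ^+ i *: \sum_(t < r.+1 | (i <= s + t)%N)
  ((q al t)`_(s + t - i) *: ffact_poly i t).
apply: (@exp_poly_C_finite _ A p) => // [al _|n].
  rewrite (leq_trans (size_scale_leq _ _)) // (leq_trans (size_sum _ _ _)) //.
  apply/bigmax_leqP => t _.
  by rewrite (leq_trans (size_scale_leq _ _)) // size_ffact_poly.
rewrite /c diffop_monomialE; apply: eq_bigr => al _.
rewrite exprD hornerZ horner_sum [RHS]mulrAC [RHS]mulrC [al ^+ i * _]mulrC.
congr (_ * _); apply: eq_big => [t|t _]; first by rewrite -addnA leq_add2l.
by rewrite hornerZ horner_ffact_poly -addnA subnDl.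
Qed.

(** * The recurrence *)

(** The recurrence is the equation read in degree n + k + e, where e is the
    exponent of nonresonance: the coefficient of a_N vanishes for N < n by the
    degree bound k, and for N > n + r + k by nonresonance. *)
Lemma nonresonant_C2_finite A r k q a : uniq A ->
    (forall al t, al \in A -> (t <= r)%N -> (size (q al t) <= k.+1)%N) ->
    nonresonant A r q (r + k) ->
    (forall n, diffop A r q a n = 0) ->
  C2_finite a (r + k) r.
Proof.
move=> A_uniq q_deg [e A_ord] a_eq.
pose L N n := diffop A r q (ps_monomial K N) n.
exists (fun i n => L (n + i)%N (n + (k + e))%N); split=> [i _|n|n].
- exact: diffop_diagonal_C_finite.
- have [] := A_ord (n + (r + k))%N (leq_addl _ _).
  by have -> : (n + (r + k) - r + e = n + (k + e))%N by lia.
pose n1 := (n + (k + e))%N.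
rewrite -[RHS](a_eq n1) diffop_monomial_sum; symmetry.
rewrite -(big_mkord xpredT (fun N => L N n1 * a N)).
have le1 : (n <= (n + (r + k)).+1)%N by lia.
have le2 : ((n + (r + k)).+1 <= (n1 + r).+1)%N by rewrite /n1; lia.
rewrite (big_cat_nat (leq0n n) (leq_trans le1 le2)) /= (big_cat_nat le1 le2) /=.
rewrite big_nat big1 => [|N /andP[_ lt_N]]; last first.
  by rewrite /L (@diffop_monomial_low _ _ _ k) ?mul0r // /n1; lia.
rewrite add0r [X in _ + X]big_nat.
rewrite [X in _ + X]big1 => [|N /andP[lt_N _]]; last first.
  have [|_ L_low] := A_ord N; first lia.
  by rewrite /L L_low ?mul0r // /n1; lia.
rewrite addr0 -{1}[n]add0n big_addn big_mkord.
have -> : ((n + (r + k)).+1 - n = (r + k).+1)%N by lia.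
by apply: eq_bigr => i _; rewrite addnC.
Qed.

End OperatorMatrix.

Theorem theorem19 (R : realType) (a : nat -> R[i]) (r k : nat)
    (A : seq R[i]) (q : R[i] -> nat -> {poly R[i]})
    (A_uniq : uniq A)
    (q_deg : forall al t, al \in A -> (t <= r)%N -> (size (q al t) <= k.+1)%N)
    (A_nonres : nonresonant A r q (r + k))
    (a_eq : forall n, diffop A r q a n = 0) :
  exists2 m : nat, (m <= r + k)%N & C2_finite a m r.
Proof.
by exists (r + k)%N => //; apply: nonresonant_C2_finite q_deg A_nonres a_eq.
Qed.
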